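(* Let $q$ be a power of an odd prime, $n\ge1$, let $\omega$ be the Weil character of $\mathrm{Sp}(2n,q)$, and let $G=\langle -I\rangle\times\{g_Q : Q\in\boldsymbol{S}_n\}\le\mathrm{Sp}(2n,q)$. (1) If $H$ is a subgroup of $G$ such that $\omega|_H$ is multiplicity free (every irreducible constituent appears with multiplicity $1$), then $|H|\ge 2q^n$. (2) This bound is attained: let $\zeta_1,\dots,\zeta_n$ be a $GF(q)$-basis of $GF(q^n)$, let $\mathrm{tr}:GF(q^n)\to GF(q)$ be the trace, and for $\alpha\in GF(q^n)$ let $Q_\alpha\in\boldsymbol{S}_n$ be the matrix with $(i,j)$ entry $\mathrm{tr}(\alpha\zeta_i\zeta_j)$. Then $H=\langle -I\rangle\times\{g_{Q_\alpha} : \alpha\in GF(q^n)\}$ is a subgroup of $G$ with $|H|=2q^n$ and $\omega|_H$ is multiplicity free.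
   Context: $q$ is a power of an odd prime $p$, $V=GF(q)^{2n}$ consists of row vectors written as pairs $(x,y)$ with $x,y\in GF(q)^n$, and $\varphi((x_1,y_1),(x_2,y_2))=x_1y_2^T-y_1x_2^T$. $\mathrm{Sp}(2n,q)$ is the group of matrices preserving $\varphi$, acting on $V$ from the right. $\boldsymbol{S}_n$ is the space of symmetric $n\times n$ matrices over $GF(q)$. For $Q\in\boldsymbol{S}_n$, $g_Q=\begin{bmatrix} I&0\\ Q&I\end{bmatrix}\in\mathrm{Sp}(2n,q)$. $\psi(\alpha)=e^{(2\pi i/p)\mathrm{tr}_{GF(q)/GF(p)}(\alpha)}$ is the canonical additive character of $GF(q)$. Weil character: up to equivalence there is a unique irreducible family of invertible operators $\pi(v)$, $v\in V$, on a complex space of dimension $q^n$ with $\pi(u)\pi(v)=\psi(\varphi(u,v))\pi(u+v)$ for all $u,v\in V$. The Weil representation is the complex linear representation $W$ of $\mathrm{Sp}(2n,q)$ on this space with $W(g)^{-1}\pi(v)W(g)=\pi(vg)$ for all $g\in \mathrm{Sp}(2n,q)$, $v\in V$, and $\omega$ is its character (of degree $q^n$). It is unique if $(n,q)\ne(1,3)$; for $(n,q)=(1,3)$ it is made unique by requiring in addition that each $W(g_Q)$ fix the vectors fixed by all $\pi(x,0)$, $x\in GF(q)^n$. *)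

(* Defs.v *)
From HB Require Import structures.
From mathcomp Require Import all_boot all_order all_algebra all_fingroup.
From mathcomp Require Import all_solvable all_field all_character.

Set Implicit Arguments.
Unset Strict Implicit.
Unset Printing Implicit Defensive.

Import Order.TTheory GRing.Theory Num.Theory GroupScope.
Local Open Scope ring_scope.

Section Trace.

Variables (F : finFieldType) (L : splittingFieldType F).

(* The trace of L over F as an element of F: [galTrace] is valued in L, and   *)
(* [fieldTraceE] shows that the default value is never used.                  *)
Definition fieldTrace (x : L) : F :=
  odflt 0 [pick c : F | c%:A == galTrace 1%AS {:L} x].

Lemma fieldTraceE x : (fieldTrace x)%:A = galTrace 1%AS {:L} x.
Proof.
rewrite /fieldTrace; case: pickP => [c /eqP // | no_c].
have /vlineP[c Dc]: galTrace 1%AS {:L} x \in 1%VS.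
  by apply: mem_galTrace (memvf x); apply: finField_galois (subvf _).
by have := no_c c; rewrite Dc eqxx.
Qed.

End Trace.

(* The number e^(2 pi i / p): [p.-root (-1)] is the p-th root of -1 of least  *)
(* nonnegative argument, namely e^(pi i / p).                                 *)
Definition zetaC (p : nat) : algC := p.-root (-1) ^+ 2.

Lemma zetaC_prim p : prime p -> odd p -> p.-primitive_root (zetaC p).
Proof.
move=> p_pr p_odd; have p_gt1 := prime_gt1 p_pr; have p_gt0 := ltnW p_gt1.
rewrite /zetaC; set r := p.-root (-1 : algC).
have rp : r ^+ p = -1 by apply: rootCK.
have zp1 : (r ^+ 2) ^+ p = 1 by rewrite exprAC rp sqrrN expr1n.
have [m prim_m m_dv_p] := prim_order_exists p_gt0 zp1.
have /primeP[_ /(_ m m_dv_p)/orP[/eqP m1|/eqP <- //]] := p_pr.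
have /eqP := prim_expr_order prim_m.
rewrite m1 expr1 -{1}(expr1n _ 2) eqf_sqr => /orP[] /eqP r1.
  by move/eqP: rp; rewrite r1 expr1n -addr_eq0 (pnatr_eq0 _ 2).
have [w prim_w] := C_prim_root_exists p_gt0.
have wp := prim_expr_order prim_w.
suffices w1 : w = 1.
  have := prim_order_dvd prim_w 1; rewrite w1 expr1n eqxx dvdn1 => /eqP p1.
  by rewrite p1 in p_gt1.
suffices root_m1 (y : algC) : 0 <= 'Im y -> y ^+ p = -1 -> y = -1.
  have wNp : (- w) ^+ p = -1 by rewrite exprNn wp -signr_odd p_odd mulr1.
  have [ge0 | lt0] := real_leP (real0 _) (Creal_Im (- w)).
    by apply: oppr_inj; apply: root_m1.
  apply: oppr_inj; apply: (can_inj conjCK); rewrite [RHS]rmorphN rmorph1.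
  apply: root_m1; first by rewrite Im_conj oppr_ge0 ltW.
  by rewrite -rmorphXn /= wNp rmorphN rmorph1.
move=> Im_ge0 yp.
have Re_le : 'Re y <= -1.
  by have := rootC_Re_max p_gt0 yp Im_ge0; rewrite -/r r1 raddfN /=
    (Creal_ReP 1 _) ?rpred1.
have norm1 : `|y| = 1.
  by apply/eqP; rewrite -(pexpr_eq1 p_gt0) // -normrX yp normrN1.
have := normC2_Re_Im y; rewrite norm1 expr1n => sum1.
have Re2 : 1 <= 'Re y ^+ 2.
  have Re_ge : 1 <= - 'Re y by rewrite lerNr.
  by rewrite -sqrrN exprn_ege1.
have Im0 : 'Im y = 0.
  apply/eqP; rewrite -sqrf_eq0 eq_le real_exprn_even_ge0 ?Creal_Im // andbT.
  by rewrite -(lerD2l ('Re y ^+ 2)) -sum1 addr0.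
move: sum1; rewrite Im0 expr0n addr0 => /esym/eqP; rewrite sqrf_eq1.
have Dy : y = 'Re y by rewrite {1}[y]Crect Im0 mulr0 addr0.
case/orP=> /eqP D; last by rewrite Dy.
by move: Re_le; rewrite D => /(le_trans ler01); rewrite oppr_ge0 ler10.
Qed.

(* tr(a) lies in the prime field 'F_p; its representative in {0, ..., p - 1}  *)
(* is used as exponent.                                                       *)
Definition psi (F : finFieldType) (p : nat) (charFp : p \in [pchar F])
    (a : F) : algC :=
  zetaC p ^+ (fieldTrace (a : pPrimeCharType charFp) : 'F_p).

Section Symplectic.

Variables (F : finFieldType) (n : nat).

(* The rank n >= 1 is written n.+1, since {'GL_m[F]} requires m >= 1; a       *)
(* vector (x, y) of V is [row_mx x y].                                        *)
Local Notation V := 'rV[F]_(n.+1 + n.+1).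
Local Notation GL := {'GL_(n.+1 + n.+1)[F]}.

Definition form (u v : V) : F :=
  (lsubmx u *m (rsubmx v)^T - rsubmx u *m (lsubmx v)^T) 0 0.

(* Matrices preserving the nondegenerate [form] are invertible, so nothing is *)
(* lost by taking them inside GL.                                             *)
Definition Sp_set : {set GL} :=
  [set g : GL |
    [forall u : V, [forall v : V, form (u *m g) (v *m g) == form u v]]].

Lemma Sp_setP (g : GL) :
  reflect (forall u v : V, form (u *m g) (v *m g) = form u v) (g \in Sp_set).
Proof.
rewrite inE; apply: (iffP forallP) => [Pg u v | Pg u].
  by have /forallP/(_ v)/eqP := Pg u.
by apply/forallP=> v; rewrite Pg.
Qed.

Lemma Sp_group_set : group_set Sp_set.
Proof.
apply/group_setP; split=> [|g h /Sp_setP Pg /Sp_setP Ph]; apply/Sp_setP=> u v.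
  by rewrite GL_1E !mulmx1.
by rewrite GL_ME !mulmxA Ph Pg.
Qed.
Canonical Sp : {group GL} := Group Sp_group_set.

Definition gQ_mx (Q : 'M[F]_n.+1) : 'M[F]_(n.+1 + n.+1) :=
  block_mx 1%:M 0 Q 1%:M.

Lemma gQ_unit Q : gQ_mx Q \is a GRing.unit.
Proof.
change (gQ_mx Q \in unitmx).
by rewrite unitmxE det_lblock !det1 mulr1 unitr1.
Qed.

Definition gQ (Q : 'M[F]_n.+1) : GL := FinRing.Unit (gQ_unit Q).

Definition negI : GL := FinRing.Unit (unitrN1 'M[F]_(n.+1 + n.+1)).

Definition sym_mx : {set 'M[F]_n.+1} := [set Q | Q^T == Q].

Definition unip_set : {set GL} := gQ @: sym_mx.

Lemma gQM Q1 Q2 : (gQ Q1 * gQ Q2)%g = gQ (Q1 + Q2).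
Proof.
apply: val_inj; rewrite /= -[LHS]/(gQ_mx Q1 *m gQ_mx Q2) mulmx_block.
by rewrite !mul1mx !mul0mx !mulmx1 !mulmx0 !addr0 !add0r.
Qed.

Lemma unip_group_set : group_set unip_set.
Proof.
apply/group_setP; split=> [|_ _ /imsetP[Q1 S1 ->] /imsetP[Q2 S2 ->]].
  apply/imsetP; exists 0; first by rewrite inE trmx0.
  by apply: val_inj; rewrite /= -[LHS]/(1%:M) (scalar_mx_block n.+1 n.+1).
rewrite gQM imset_f // inE linearD /=.
by move: S1 S2; rewrite !inE => /eqP-> /eqP->.
Qed.
Canonical unip : {group GL} := Group unip_group_set.

Definition G : {group GL} := (<[negI]> <*> unip)%G.

Lemma negI_mul v : v *m negI = - v :> V.
Proof. by change (v *m (- (1%:M)) = - v); rewrite mulmxN mulmx1. Qed.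

Lemma negI_comm g : commute negI g.
Proof. by apply: val_inj; rewrite /= mulN1r mulrN1. Qed.

Lemma mul_row_gQ (x y : 'rV[F]_n.+1) Q :
  (row_mx x y : V) *m gQ Q = row_mx (x + y *m Q) y :> V.
Proof.
change (row_mx x y *m gQ_mx Q = row_mx (x + y *m Q) y).
by rewrite mul_row_block !mulmx0 !mulmx1 add0r.
Qed.

Lemma G_sub_Sp : G \subset Sp.
Proof.
rewrite join_subG cycle_subG; apply/andP; split.
  apply/Sp_setP=> u v; rewrite !negI_mul /form !linearN /=.
  by rewrite !mulNmx !opprK.
apply/subsetP=> _ /imsetP[Q + ->]; rewrite inE => /eqP symQ.
apply/Sp_setP=> u v.
rewrite -[u]hsubmxK -[v]hsubmxK !mul_row_gQ.
rewrite /form !row_mxKl !row_mxKr !linearD /= !trmx_mul symQ.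
by rewrite mulmxDl mulmxA addrACA subrr addr0.
Qed.

Lemma G_dprod : 2%:R != 0 :> F -> <[negI]> \x unip = G :> {set GL}.
Proof.
move=> F2; apply: dprodEY.
  by rewrite centsC cycle_subG; apply/centP=> g _; apply: negI_comm.
apply/trivgP/subsetP=> _ /setIP[/cycleP[k ->] /imsetP[Q _ Dk]].
apply/set1P; have [//|] : (negI ^+ k = 1)%g \/ (negI ^+ k = negI)%g.
  have N2 : (negI ^+ 2 = 1)%g by apply: val_inj; rewrite /= mulrNN mulr1.
  rewrite -(odd_double_half k) expgD -mul2n expgM N2 expg1n mulg1.
  by case: (odd k); [right | left].
move=> Nk; move: Dk; rewrite Nk => /(congr1 val) /=.
change (- (1%:M : 'M[F]_(n.+1 + n.+1)) = gQ_mx Q -> negI = 1%g).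
move=> /matrixP/(_ (lshift _ 0) (lshift _ 0)).
rewrite block_mxEul !mxE eqxx => /eqP; rewrite eq_sym -subr_eq0 opprK.
by rewrite -(natrD _ 1 1) (negbTE F2).
Qed.

Section Weil.

Variables (p : nat) (charFp : p \in [pchar F]).

(* Complex representations and characters are over [algC], as in 'CF(_).      *)
(* The complex space of dimension q ^ n is the space of column vectors, on    *)
(* which matrices act from the left, so that *m is composition of operators.  *)
Local Notation dim := (#|F| ^ n.+1)%N.
Local Notation op := 'M[algC]_dim.

Definition irreducible_family (pi : V -> op) : Prop :=
  forall U : {vspace 'cV[algC]_dim},
    (forall v w, w \in U -> pi v *m w \in U) -> U = 0%VS \/ U = fullv.

Definition Heisenberg_family (pi : V -> op) : Prop :=
  [/\ forall v, pi v \in unitmx,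
      irreducible_family pi
    & forall u v, pi u *m pi v = psi charFp (form u v) *: pi (u + v)].

(* The second clause is the normalisation needed only for (n, q) = (1, 3).    *)
Definition Weil_representation (pi : V -> op)
    (W : mx_representation algC Sp dim) : Prop :=
  (forall (g : GL) (v : V), g \in Sp ->
      invmx (W g) *m pi v *m W g = pi (v *m g))
  /\ (n.+1 = 1%N -> #|F| = 3%N ->
      forall Q : 'M_n.+1, Q \in sym_mx -> forall w : 'cV_dim,
        (forall x : 'rV_n.+1, pi (row_mx x 0) *m w = w) -> W (gQ Q) *m w = w).

Definition Weil_character (omega : 'CF(Sp)) : Prop :=
  exists pi : V -> op, exists W : mx_representation algC Sp dim,
    [/\ Heisenberg_family pi, Weil_representation pi W & omega = cfRepr W].

End Weil.

(* The matrix Q_alpha; [finvect_type L] is L with its finite field structure. *)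
Definition trace_mx (L : fieldExtType F) (zeta : n.+1.-tuple L)
    (alpha : L) : 'M[F]_n.+1 :=
  \matrix_(i, j)
     fieldTrace (alpha * tnth zeta i * tnth zeta j : finvect_type L).

End Symplectic.

Definition multiplicity_free (gT : finGroupType) (H : {group gT})
    (phi : 'CF(H)) : Prop :=
  forall i, i \in irr_constt phi -> '[phi, 'chi_i] = 1.

(* Main.v *)
(* Let [P] be the average of the commuting operators [pi (x, 0)]. The         *)
(* conjugates of the idempotent [P] by the [pi (0, y)] sum to 1, so [P] has   *)
(* trace and rank 1. Elements of [G] stabilise the subspace of all [(x, 0)],  *)
(* hence [W g] commutes with [P] and acts on its image by a scalar [mu g];    *)
(* [mu] is a linear character of [G]. Computing traces along the conjugates   *)
(* of [P] gives                                                               *)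
(*   omega (g_Q) = mu (g_Q) * sum_y psi (- y Q y^T),                          *)
(*   omega (- g_Q) = mu (- g_Q),                                              *)
(* the second because -I swaps the lines attached to y and -y.                *)
(* Since y and -y give the same character of the g_Q, a subgroup [H] of [G]   *)
(* on which omega is multiplicity free contains -I, so [#|H| = 2 p^a]; having *)
(* at most [#|H|] constituents forces [q^n <= 2 p^a], hence [q^n <= p^a].     *)
(* Conversely, when -I is in [H], omega is multiplicity free on [H] as soon   *)
(* as the characters of y and z agree only for z = y or z = - y; for the      *)
(* matrices Q_alpha one has y Q_alpha y^T = tr (alpha Y^2) with               *)
(* Y = sum_i y_i zeta_i, and Y^2 determines Y up to sign.                     *)

Require Import Defs.
From HB Require Import structures.
From mathcomp Require Import all_boot all_order all_algebra all_fingroup.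
From mathcomp Require Import all_solvable all_field all_character.

Set Implicit Arguments.
Unset Strict Implicit.
Unset Printing Implicit Defensive.

Import Order.TTheory GRing.Theory Num.Theory GroupScope.
Local Open Scope ring_scope.

(** * Traces and the canonical additive character *)

(** The idempotents [Y y *m XProj *m Y (- y)] have rank 1 and sum to 1 ([mxrank_XProj],
    [sum_conj_XProj]), so the Weil space splits into q^n lines indexed by y. On it [G] acts
    monomially: g_Q scales the line of y by mu(g_Q) psi(- y Q y^T), and -I swaps the lines of y and
    - y (traces in [mxtrace_Weil_conj]). Here mu is a linear character of [G] ([Weil_eigenM]), and
    y, - y always give the same character [quad_char] of the g_Q.

    Lower bound: a subgroup [H] without -I contains only elements g_Q ([sub_unip]), so a pair y, - y
    with y != 0 yields a repeated constituent; hence -I is in [H] ([Weil_multfree_negI]). As [H] is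
    abelian, q^n is at most #|H| = 2 p^a ([multiplicity_free_abelian_degree]), and q^n is itself a
    power of p > 2, so q^n <= p^a.

    Attainment: if -I is in [H], it separates the two constituents carried by the lines of y and -
    y, so it suffices that [quad_char] determine y up to sign ([Weil_multfree_separated]). For the
    Q_alpha this follows from y Q_alpha y^T = tr(alpha Y^2), Y = sum_i y_i zeta_i, and nondegeneracy
    of the trace ([trace_form], [trace_form_separates]). *)

Section TraceTheory.

Variables (F : finFieldType) (L : splittingFieldType F).
Implicit Types x y : L.

Lemma fieldTrace_unique x (c : F) :
  galTrace 1%AS {:L} x = c%:A -> fieldTrace x = c.
Proof.
rewrite -fieldTraceE => /eqP; rewrite -subr_eq0 -scalerBl scaler_eq0.
by rewrite oner_eq0 orbF subr_eq0 => /eqP.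
Qed.

Lemma fieldTraceB x y : fieldTrace (x - y) = fieldTrace x - fieldTrace y.
Proof.
apply: fieldTrace_unique; rewrite scalerBl !fieldTraceE.
exact: galTrace_is_zmod_morphism.
Qed.

Lemma fieldTrace0 : fieldTrace (0 : L) = 0.
Proof. by have := fieldTraceB 0 0; rewrite !subrr. Qed.

Lemma fieldTraceD x y : fieldTrace (x + y) = fieldTrace x + fieldTrace y.
Proof.
apply: fieldTrace_unique; rewrite scalerDl !fieldTraceE.
by rewrite /galTrace -big_split; apply: eq_bigr => s _; rewrite rmorphD.
Qed.

Lemma fieldTrace_sum I (r : seq I) (P : pred I) (f : I -> L) :
  fieldTrace (\sum_(i <- r | P i) f i) = \sum_(i <- r | P i) fieldTrace (f i).
Proof. by apply: (big_morph _ fieldTraceD fieldTrace0). Qed.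

Lemma fieldTraceZ (c : F) x : fieldTrace (c *: x) = c * fieldTrace x.
Proof.
apply: fieldTrace_unique; rewrite -scalerA fieldTraceE /galTrace scaler_sumr.
by apply: eq_bigr => s _; rewrite linearZ.
Qed.

(** Dedekind independence of the Galois automorphisms, applied with all coefficients equal to 1. *)
Lemma fieldTrace_neq0 : exists x, fieldTrace x != 0.
Proof.
have P1 : (1%g : gal_of {:L}) \in 'Gal({:L} / 1%AS) by apply: group1.
have [a _ nz] := gal_independent_contra
  (P := [in 'Gal({:L} / 1%AS)]) (c_ := fun=> 1) P1 (oner_neq0 _).
exists a; apply: contraNneq nz => tr0; under eq_bigr do rewrite mul1r.
by rewrite -/(galTrace 1%AS {:L} a) -fieldTraceE tr0 scale0r.
Qed.

Lemma fieldTrace_surj (c : F) : exists x, fieldTrace x = c.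
Proof.
have [x nz_x] := fieldTrace_neq0; exists ((c / fieldTrace x) *: x).
by rewrite fieldTraceZ divfK.
Qed.

Lemma fieldTrace_nondeg x (c : F) : x != 0 -> exists y, fieldTrace (y * x) = c.
Proof.
by move=> nz_x; have [y <-] := fieldTrace_surj c; exists (y / x); rewrite divfK.
Qed.

End TraceTheory.

Section Psi.

Variables (F : finFieldType) (p : nat).
Variables (charFp : p \in [pchar F]) (p_odd : odd p).

Let p_pr : prime p := pcharf_prime charFp.
Let prim_z : p.-primitive_root (zetaC p) := zetaC_prim p_pr p_odd.

Lemma psiD a b : psi charFp (a + b) = psi charFp a * psi charFp b.
Proof.
rewrite /psi (fieldTraceD (a : pPrimeCharType charFp)) -exprD.
rewrite -[RHS](prim_expr_mod prim_z) /=.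
(* Addition in ['F_p] reduces modulo [(Zp_trunc (pdiv p)).+2], which equals p because p is prime. *)
by congr (_ ^+ (_ %% _)); apply: Fp_cast.
Qed.

Lemma psi0 : psi charFp 0 = 1.
Proof. by rewrite /psi (fieldTrace0 (pPrimeCharType charFp)). Qed.

Lemma psiK a : psi charFp a * psi charFp (- a) = 1.
Proof. by rewrite -psiD subrr psi0. Qed.

Lemma psi_neq0 a : psi charFp a != 0.
Proof.
by apply: contra_eq_neq (psiK a) => ->; rewrite mul0r eq_sym oner_eq0.
Qed.

Lemma psiN a : psi charFp (- a) = (psi charFp a)^-1.
Proof. by apply: (mulfI (psi_neq0 a)); rewrite psiK divff ?psi_neq0. Qed.

Lemma psi_nontrivial : exists a, psi charFp a != 1.
Proof.
have [a tr_a] := fieldTrace_surj (pPrimeCharType charFp) 1.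
exists a; rewrite /psi tr_a -(prim_order_dvd prim_z) /= modn_small //.
by rewrite dvdn1 neq_ltn prime_gt1 ?orbT.
Qed.

End Psi.

(** * Linear algebra *)

(** Cancelling the outer factors of C R C R = C R, for a rank factorisation P = C R, gives R C = 1;
    the trace of C R is then that of an identity matrix of size the rank. *)
Lemma mxtrace_idem (K : fieldType) (m : nat) (P : 'M[K]_m) :
  P *m P = P -> \tr P = (\rank P)%:R.
Proof.
move=> PP; have [B CB] := row_fullP (col_base_full P).
have [D RD] := row_freeP (row_base_free P).
move: (col_base P) (row_base P) (mulmx_base P) CB RD => C R CR CB RD.
suffices RC : R *m C = 1%:M by rewrite -{1}CR mxtrace_mulC RC mxtrace1.
have := PP; rewrite -{1 2 3}CR => /(congr1 (mulmx B)).
rewrite /= !mulmxA CB mul1mx -!mulmxA => /(congr1 (mulmx^~ D)).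
by rewrite /= -!mulmxA RD !mulmx1.
Qed.

(** With P = u v for a column u and a row v, P A P = (v A u) P, and the scalar v A u is the trace of
    A P. *)
Lemma mulmx_rank1_comm (K : fieldType) (m : nat) (P A : 'M[K]_m) :
  P *m P = P -> \rank P = 1 -> A *m P = P *m A ->
  A *m P = \tr (A *m P) *: P.
Proof.
move=> PP rkP AP; have PAP : P *m A *m P = A *m P by rewrite -AP -mulmxA PP.
move: (col_base P) (row_base P) (mulmx_base P); rewrite rkP => u v DP.
have -> : \tr (A *m P) = (v *m A *m u) 0 0.
  by rewrite -DP mulmxA mxtrace_mulC mulmxA trace_mx11.
rewrite -PAP -[X in X *m A]DP -[X in _ *m X]DP.
rewrite -[u *m v *m A]mulmxA mulmxA -[u *m _ *m u]mulmxA.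
by rewrite [in LHS](mx11_scalar (v *m A *m u)) mul_mx_scalar -scalemxAl DP.
Qed.

Section Bilinear.

Variables (F : finFieldType) (m : nat).
Implicit Types x y : 'rV[F]_m.

Definition rowdot x y : F := (x *m y^T) 0 0.

Lemma rowdotDl x1 x2 y : rowdot (x1 + x2) y = rowdot x1 y + rowdot x2 y.
Proof. by rewrite /rowdot mulmxDl mxE. Qed.

Lemma rowdotDr x y1 y2 : rowdot x (y1 + y2) = rowdot x y1 + rowdot x y2.
Proof. by rewrite /rowdot linearD mulmxDr mxE. Qed.

Lemma rowdotNl x y : rowdot (- x) y = - rowdot x y.
Proof. by rewrite /rowdot mulNmx mxE. Qed.

Lemma rowdotNr x y : rowdot x (- y) = - rowdot x y.
Proof. by rewrite /rowdot linearN mulmxN mxE. Qed.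

Lemma rowdotZr c x y : rowdot x (c *: y) = c * rowdot x y.
Proof. by rewrite /rowdot linearZ -scalemxAr mxE. Qed.

Lemma rowdot0l y : rowdot 0 y = 0.
Proof. by rewrite /rowdot mul0mx mxE. Qed.

Lemma rowdot0r x : rowdot x 0 = 0.
Proof. by rewrite /rowdot trmx0 mulmx0 mxE. Qed.

Lemma rowdotC x y : rowdot x y = rowdot y x.
Proof. by rewrite /rowdot -{1}(trmxK x) -trmx_mul mxE. Qed.

Lemma rowdot_nondeg x c : x != 0 -> exists y, rowdot x y = c.
Proof.
case/rV0Pn=> i nz_xi; exists ((c / x 0 i) *: delta_mx 0 i).
rewrite rowdotZr /rowdot mxE (bigD1 i) //= big1 => [|j /negbTE ne_ji].
  by rewrite !mxE !eqxx mulr1 addr0 divfK.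
by rewrite !mxE eqxx ne_ji mulr0.
Qed.

Variables (p : nat) (charFp : p \in [pchar F]) (p_odd : odd p).

Lemma psi_rowdot_neq1 (c : F) x :
  c != 0 -> x != 0 -> exists y, psi charFp (c * rowdot x y) != 1.
Proof.
move=> nz_c nz_x; have [a psi_a] := psi_nontrivial charFp p_odd.
by have [y Dy] := rowdot_nondeg (a / c) nz_x; exists y; rewrite Dy mulrC divfK.
Qed.

(** For x != 0, translating y by a suitable z multiplies the sum by a factor different from 1. *)
Lemma sum_psi_rowdot (c : F) x : c != 0 ->
  \sum_y psi charFp (c * rowdot x y) = (x == 0)%:R * (#|F| ^ m)%:R.
Proof.
move=> nz_c; have [-> | nz_x] := eqVneq x 0.
  under eq_bigr do rewrite rowdot0l mulr0 psi0.
  by rewrite sumr_const card_mx mul1n mul1r.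
have [z psi_z] := psi_rowdot_neq1 nz_c nz_x; set S := (LHS); rewrite mul0r.
suffices /eqP : S = psi charFp (c * rowdot x z) * S.
  rewrite -subr_eq0 -{1}[S]mul1r -mulrBl mulf_eq0 subr_eq0 eq_sym.
  by rewrite (negbTE psi_z) => /eqP.
rewrite {1}/S (reindex_inj (addrI z)) mulr_sumr; apply: eq_bigr => y _.
by rewrite rowdotDr mulrDr psiD.
Qed.

End Bilinear.

Lemma form_row_mx (F : finFieldType) (n : nat) (x1 y1 x2 y2 : 'rV[F]_n.+1) :
  Defs.form (row_mx x1 y1) (row_mx x2 y2) = rowdot x1 y2 - rowdot y1 x2.
Proof. by rewrite /Defs.form /rowdot !row_mxKl !row_mxKr !mxE. Qed.

Lemma pchar_odd_nat2_neq0 (F : finFieldType) (p : nat) :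
  p \in [pchar F] -> odd p -> 2%:R != 0 :> F.
Proof.
move=> charFp p_odd; rewrite -(dvdn_pcharf charFp).
apply: contraL p_odd.
by rewrite dvdn_prime2 ?(pcharf_prime charFp) // => /eqP->.
Qed.

Lemma mem_GP (F : finFieldType) (n : nat) (g : {'GL_(n.+1 + n.+1)[F]}) :
  g \in G F n ->
  exists (b : bool) (Q : 'M[F]_n.+1),
    Q \in sym_mx F n /\ g = (negI F n ^+ b * gQ Q)%g.
Proof.
rewrite /G /= norm_joinEl; last first.
  by rewrite cents_norm // cycle_subG; apply/centP=> h _; apply: negI_comm.
case/mulsgP=> _ _ /cycleP[k ->] /imsetP[Q symQ ->] ->.
have N2 : (negI F n ^+ 2 = 1)%g by apply: val_inj; rewrite /= mulrNN mulr1.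
exists (odd k), Q; split=> //; congr (_ * _)%g.
by rewrite -{1}(odd_double_half k) expgD -mul2n expgM N2 expg1n mulg1.
Qed.

(** * Traces of the Weil operators on G *)

Section WeilTrace.

Variables (F : finFieldType) (n p : nat).
Variables (charFp : p \in [pchar F]) (p_odd : odd p).

Local Notation V := 'rV[F]_(n.+1 + n.+1).
Local Notation GL := {'GL_(n.+1 + n.+1)[F]}.
Local Notation dim := (#|F| ^ n.+1)%N.
Local Notation psi := (@psi F p charFp).


Variables (pi : V -> 'M[algC]_dim) (W : mx_representation algC (Sp F n) dim).
Hypothesis Hpi : Heisenberg_family charFp pi.
Hypothesis HW : Weil_representation pi W.

Implicit Types (x y : 'rV[F]_n.+1) (g h : GL) (Q : 'M[F]_n.+1).

Let F2 : 2%:R != 0 :> F := pchar_odd_nat2_neq0 charFp p_odd.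
Let dim_neq0 : dim%:R != 0 :> algC.
Proof. by rewrite pnatr_eq0 -lt0n expn_gt0 ltnW ?finNzRing_gt1. Qed.

Local Notation X x := (pi (row_mx x 0)).
Local Notation Y y := (pi (row_mx 0 y)).

Lemma Heisenberg_mul u v : pi u *m pi v = psi (Defs.form u v) *: pi (u + v).
Proof. by have [_ _ ->] := Hpi. Qed.

Lemma Heisenberg0 : pi 0 = 1%:M.
Proof.
have [U _ M] := Hpi; have := M 0 0.
rewrite -row_mx0 form_row_mx rowdot0l subrr psi0 scale1r row_mx0 addr0.
by move/(congr1 (mulmx (invmx (pi 0)))); rewrite mulmxA mulVmx // mul1mx.
Qed.

Lemma Heisenberg_XX x1 x2 : X x1 *m X x2 = X (x1 + x2).
Proof.
rewrite Heisenberg_mul form_row_mx rowdot0l rowdot0r subr0 psi0 scale1r.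
by rewrite add_row_mx addr0.
Qed.

Lemma Heisenberg_YY y1 y2 : Y y1 *m Y y2 = Y (y1 + y2).
Proof.
rewrite Heisenberg_mul form_row_mx rowdot0l rowdot0r subr0 psi0 scale1r.
by rewrite add_row_mx addr0.
Qed.

Lemma Heisenberg_YX x y : Y y *m X x = psi (- rowdot x y) *: pi (row_mx x y).
Proof.
rewrite Heisenberg_mul form_row_mx rowdot0l sub0r [rowdot y x]rowdotC.
by rewrite add_row_mx addr0 add0r.
Qed.

Lemma Heisenberg_YXE x y : pi (row_mx x y) = psi (rowdot x y) *: (Y y *m X x).
Proof. by rewrite Heisenberg_YX scalerA psiK // scale1r. Qed.

Lemma Heisenberg_XY x y : X x *m Y y = psi (2%:R * rowdot x y) *: (Y y *m X x).
Proof.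
rewrite Heisenberg_mul form_row_mx rowdot0l subr0 add_row_mx addr0 add0r.
by rewrite (Heisenberg_YXE x y) scalerA -psiD // mulr_natl.
Qed.

(** The projection onto the vectors fixed by all [X x]. *)
Definition XProj : 'M[algC]_dim := dim%:R^-1 *: \sum_x X x.
Local Notation P0 := XProj.

Lemma mul_X_XProj x : X x *m P0 = P0.
Proof.
rewrite /XProj -scalemxAr mulmx_sumr; congr (_ *: _).
rewrite [RHS](reindex_inj (addrI x)).
by apply: eq_bigr => z _; apply: Heisenberg_XX.
Qed.

Lemma XProj_idem : P0 *m P0 = P0.
Proof.
rewrite {1}/XProj -scalemxAl mulmx_suml; under eq_bigr do rewrite mul_X_XProj.
by rewrite sumr_const card_mx mul1n -scaler_nat scalerA mulVf // scale1r.
Qed.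

(** Conjugation by [Y y] multiplies [X x] by psi(- 2 x y^T), so summing over y leaves only the term
    x = 0 of the average. *)
Lemma sum_conj_XProj : \sum_y Y y *m P0 *m Y (- y) = 1%:M.
Proof.
have YXY x y : Y y *m X x *m Y (- y) = psi (- 2%:R * rowdot x y) *: X x.
  rewrite -mulmxA Heisenberg_XY -scalemxAr mulmxA Heisenberg_YY subrr.
  by rewrite row_mx0 Heisenberg0 mul1mx rowdotNr mulrN mulNr.
under eq_bigr do rewrite /XProj -scalemxAr -scalemxAl mulmx_sumr mulmx_suml.
rewrite -scaler_sumr exchange_big /= (bigD1 0) //=.
rewrite [Z in _ + Z]big1 => [|x nz_x].
  under eq_bigr do rewrite YXY.
  rewrite -scaler_suml sum_psi_rowdot ?oppr_eq0 // eqxx mul1r addr0 scalerA.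
  by rewrite mulVf // scale1r row_mx0 Heisenberg0.
under eq_bigr do rewrite YXY.
by rewrite -scaler_suml sum_psi_rowdot ?oppr_eq0 // (negbTE nz_x) mul0r scale0r.
Qed.

(** The q^n conjugates all have the trace of [XProj], and their sum, the identity, has trace q^n. *)
Lemma mxtrace_XProj : \tr P0 = 1.
Proof.
apply: (mulfI dim_neq0); rewrite mulr1 -[RHS](mxtrace1 algC dim).
rewrite -sum_conj_XProj.
rewrite raddf_sum /= (eq_bigr (fun=> \tr P0)) => [|y _].
  by rewrite sumr_const card_mx mul1n mulr_natl.
rewrite mxtrace_mulC mulmxA Heisenberg_YY addNr row_mx0 Heisenberg0.
by rewrite mul1mx.
Qed.

Lemma mxrank_XProj : \rank P0 = 1.
Proof.
apply/eqP; rewrite -(eqr_nat algC) -mxtrace_idem ?mxtrace_XProj //.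
exact: XProj_idem.
Qed.

(** [XProj] absorbs [X x] on both sides, while moving [X x] past [Y y] costs psi(2 x y^T), which
    differs from 1 for some x when y != 0. *)
Lemma mxtrace_Y_XProj y : \tr (Y y *m P0) = (y == 0)%:R.
Proof.
have [-> | nz_y] := eqVneq.
  by rewrite row_mx0 Heisenberg0 mul1mx mxtrace_XProj.
have [x] := psi_rowdot_neq1 charFp p_odd F2 nz_y; rewrite rowdotC => psi_x.
suffices /eqP : \tr (Y y *m P0) = psi (2%:R * rowdot x y) * \tr (Y y *m P0).
  rewrite -subr_eq0 -{1}[\tr _]mul1r -mulrBl mulf_eq0 subr_eq0 eq_sym.
  by rewrite (negbTE psi_x) => /eqP.
rewrite -mxtraceZ -{2}(mul_X_XProj x) mulmxA scalemxAl -Heisenberg_XY.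
rewrite -mulmxA [RHS]mxtrace_mulC -mulmxA; congr (\tr (_ *m _)).
rewrite /XProj -scalemxAl mulmx_suml; congr (_ *: _).
rewrite (reindex_inj (addIr x)).
by apply: eq_bigr => z _; rewrite Heisenberg_XX.
Qed.

Lemma Weil_intertwine g v : g \in Sp F n -> pi v *m W g = W g *m pi (v *m g).
Proof.
move=> Sg; rewrite -(proj1 HW) // mulmxA mulKVmx //.
exact: repr_mx_unit.
Qed.

Lemma negI_gQ_act (b : bool) g x y Q : g = (negI F n ^+ b * gQ Q)%g ->
  (row_mx x y : V) *m g = (-1) ^+ b *: row_mx (x + y *m Q) y :> V.
Proof.
move=> ->; rewrite -mul_row_gQ; case: b; last by rewrite expg0 mul1g scale1r.
rewrite expg1 GL_ME mulmxA negI_mul expr1 scaleN1r.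
by rewrite mulNmx.
Qed.

(** Elements of [G] send (x, 0) to (x, 0) or (- x, 0), so conjugation by [W g] permutes the terms of
    the average. *)
Lemma Weil_XProj_comm g : g \in G F n -> W g *m P0 = P0 *m W g.
Proof.
move=> Gg; have Sg := subsetP (G_sub_Sp F n) g Gg.
have [a nz_a Da] : exists2 a : F, a != 0 &
    forall x, (row_mx x 0 : V) *m g = row_mx (a *: x) 0 :> V.
  have [b [Q [_ Dg]]] := mem_GP Gg.
  exists ((-1) ^+ b) => [|x]; first by rewrite signr_eq0.
  by rewrite (negI_gQ_act _ _ Dg) mul0mx addr0 scale_row_mx scaler0.
rewrite /XProj -scalemxAl -scalemxAr mulmx_suml mulmx_sumr; congr (_ *: _).
rewrite (reindex_inj (scalerI nz_a)).
by apply: eq_bigr => x _; rewrite Weil_intertwine // Da.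
Qed.

(** For g in [G], the eigenvalue of [W g] on the line that is the image of [XProj]. *)
Definition Weil_eigen g : algC := \tr (W g *m P0).
Local Notation mu := Weil_eigen.

Lemma Weil_eigenE g : g \in G F n -> W g *m P0 = mu g *: P0.
Proof.
move=> Gg; apply: mulmx_rank1_comm (Weil_XProj_comm Gg).
  exact: XProj_idem.
exact: mxrank_XProj.
Qed.

Lemma Weil_eigenM : {in G F n &, {morph mu : g h / (g * h)%g >-> g * h}}.
Proof.
move=> g h Gg Gh; have sub := subsetP (G_sub_Sp F n).
rewrite {1}/mu repr_mxM ?sub // -mulmxA Weil_eigenE // -scalemxAr.
by rewrite Weil_eigenE // 2!mxtraceZ mxtrace_XProj mulr1 mulrC.
Qed.

Lemma Weil_eigen1 : mu 1%g = 1.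
Proof. by rewrite /mu repr_mx1 mul1mx mxtrace_XProj. Qed.

(** With s the sign of g, the vector v = (- s y Q, s y) satisfies v g = (0, y), so [Y y] on the
    right of [W g] becomes [pi v] on its left. On the image of [XProj], [W g] is the scalar mu(g)
    and the X part of [pi v] is absorbed; what remains is the trace of [Y ((s - 1) y)] against
    [XProj]. *)
Lemma mxtrace_Weil_conj (b : bool) Q y : Q \in sym_mx F n ->
  \tr (W (negI F n ^+ b * gQ Q)%g *m (Y y *m P0 *m Y (- y)))
    = mu (negI F n ^+ b * gQ Q)%g
      * (psi (- rowdot (y *m Q) y) * (b ==> (y == 0))%:R).
Proof.
move=> symQ; set g : GL := (_ * _)%g.
have Gg : g \in G F n.
  rewrite groupM ?groupX ?mem_gen // inE; first by rewrite cycle_id.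
  by rewrite (imset_f _ symQ) orbT.
have Sg := subsetP (G_sub_Sp F n) g Gg.
pose s : F := (-1) ^+ b.
have Dy : (row_mx (- s *: (y *m Q)) (s *: y) : V) *m g = row_mx 0 y :> V.
  rewrite (negI_gQ_act _ _ (erefl g)) -scalemxAl scaleNr addNr.
  rewrite scale_row_mx scaler0 scalerA.
  by rewrite -expr2 sqrr_sign scale1r.
rewrite !mulmxA -{1}Dy -Weil_intertwine // -[_ *m P0]mulmxA Weil_eigenE //.
rewrite -scalemxAr -scalemxAl mxtraceZ; congr (_ * _).
rewrite Heisenberg_YXE -2!scalemxAl mxtraceZ; congr (_ * _).
  congr psi; rewrite rowdotZr rowdotC rowdotZr mulrA mulrN -expr2 sqrr_sign.
  by rewrite mulN1r rowdotC.
rewrite -[_ *m P0]mulmxA mul_X_XProj mxtrace_mulC mulmxA Heisenberg_YY.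
rewrite mxtrace_Y_XProj; congr (nat_of_bool _)%:R.
rewrite -{1}(scaleN1r y) -scalerDl scaler_eq0 /s; case: (b) => /=.
  by rewrite -opprD oppr_eq0 (negbTE F2).
by rewrite addNr eqxx.
Qed.

Lemma mxtrace_Weil (b : bool) Q : Q \in sym_mx F n ->
  \tr (W (negI F n ^+ b * gQ Q)%g)
    = mu (negI F n ^+ b * gQ Q)%g
      * \sum_y psi (- rowdot (y *m Q) y) * (b ==> (y == 0))%:R.
Proof.
move=> symQ; rewrite -{1}[W _]mulmx1 -sum_conj_XProj mulmx_sumr raddf_sum.
by rewrite mulr_sumr; apply: eq_bigr => y _; apply: mxtrace_Weil_conj.
Qed.

End WeilTrace.

(** * Subgroups of G and their characters *)

Section LinearCharacters.

Variable gT : finGroupType.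
Implicit Types (H : {group gT}) (f : gT -> algC).

Lemma morph_irr H f :
    f 1%g = 1 -> {in H &, {morph f : g h / (g * h)%g >-> g * h}} ->
  exists i, {in H, 'chi[H]_i =1 f}.
Proof.
move=> f1 fM; have f_repr : mx_repr H (fun h => (f h)%:M : 'M_1).
  by split=> [|g h Hg Hh]; rewrite ?f1 // fM // scalar_mxM.
have : cfRepr (MxRepresentation f_repr) \is a linear_char.
  by rewrite qualifE /= cfRepr_char cfRepr1 eqxx.
case/lin_char_irr/irrP => i Di; exists i => h Hh.
by rewrite -Di cfunE Hh mulr1n mxtrace_scalar mulr1n.
Qed.

Lemma sum_morph H f : {in H &, {morph f : g h / (g * h)%g >-> g * h}} ->
  f 1%g = 1 ->
  \sum_(h in H) f h = [forall h in H, f h == 1]%:R * #|H|%:R.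
Proof.
move=> fM f1; have [f_eq1 | ] := boolP [forall h in H, f h == 1].
  rewrite (eq_bigr (fun=> 1)) ?sumr_const ?mul1r // => h Hh.
  exact/eqP/(forall_inP f_eq1).
rewrite negb_forall => /existsP[g]; rewrite negb_imply => /andP[Hg fg].
set S := (LHS); rewrite mul0r.
suffices /eqP : S = f g * S.
  rewrite -subr_eq0 -{1}[S]mul1r -mulrBl mulf_eq0 subr_eq0 eq_sym.
  by rewrite (negbTE fg) => /eqP.
rewrite {1}/S (reindex_inj (mulgI g)) mulr_sumr.
by apply: eq_big => [h | h]; rewrite groupMl // => Hh; rewrite fM.
Qed.

(** There are #|H| irreducible characters, all linear, and each contributes 0 or 1 to the value at
    1. *)
Lemma multiplicity_free_abelian_degree H (phi : 'CF(H)) :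
  abelian H -> multiplicity_free phi -> phi 1%g <= #|H|%:R.
Proof.
move=> cHH mf; rewrite [phi]cfun_sum_cfdot sum_cfunE -(card_Iirr_abelian cHH).
rewrite -sumr_const; apply: ler_sum => i _.
rewrite cfunE lin_char1 ?mulr1; last exact: (char_abelianP H cHH).
have [/mf-> // | ] := boolP (i \in irr_constt phi).
by rewrite irr_consttE negbK => /eqP->; apply: ler01.
Qed.

End LinearCharacters.

(** * The two cosets of the unipotent part in G *)

Section ElementsOfG.

Variables (F : finFieldType) (n p : nat).
Variables (charFp : p \in [pchar F]) (p_odd : odd p).

Local Notation GL := {'GL_(n.+1 + n.+1)[F]}.
Local Notation negI := (negI F n).
Implicit Types (g h : GL) (H : {group GL}).

Let F2 : 2%:R != 0 :> F := pchar_odd_nat2_neq0 charFp p_odd.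

Lemma negI2 : (negI * negI)%g = 1%g.
Proof. by apply: val_inj; rewrite /= mulrNN mulr1. Qed.

Lemma negI_G : negI \in G F n.
Proof. by rewrite mem_gen // inE cycle_id. Qed.

Lemma unip_sub_G : unip F n \subset G F n.
Proof. exact: joing_subr. Qed.

Lemma gQ_unip Q : Q \in sym_mx F n -> gQ Q \in unip F n.
Proof. exact: imset_f. Qed.

Lemma G_abelian : abelian (G F n).
Proof.
have cN k z : commute z (negI ^+ k) by apply/commuteX/commute_sym/negI_comm.
apply/centsP=> g /mem_GP[b [Q [_ ->]]] h /mem_GP[c [R [_ ->]]].
apply: commuteM (cN _ _) (commute_sym (commuteM (cN _ _) _)).
by rewrite /commute !gQM addrC.
Qed.

Lemma negI_notin_unip : negI \notin unip F n.
Proof.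
apply/negP=> uN; have /dprodP[_ _ _ TI] := G_dprod n F2.
have : negI \in (<[negI]> :&: unip F n)%g by rewrite inE cycle_id.
rewrite TI => /set1P/(congr1 val)/= /matrixP/(_ 0 0); rewrite !mxE /=.
by move/eqP; rewrite eq_sym -subr_eq0 opprK -(natrD _ 1 1) (negbTE F2).
Qed.

(** [G] consists of [unip] and its coset by -I, and these are disjoint in odd characteristic. *)
Lemma mem_negI_unip g : g \in G F n ->
  (negI * g \in unip F n)%g = (g \notin unip F n).
Proof.
case/mem_GP=> b [Q [symQ ->]]; have uQ := gQ_unip symQ.
case: b; rewrite ?expg1 ?expg0 ?mul1g ?mulgA ?negI2 ?mul1g uQ groupMr //.
  by rewrite negI_notin_unip.
exact/negbTE/negI_notin_unip.
Qed.

Lemma sum_G_split (V : nmodType) H (f : GL -> V) :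
    H \subset G F n -> negI \in H ->
  \sum_(h in H) f h = \sum_(h in H :&: unip F n) (f h + f (negI * h)%g).
Proof.
move=> sHG HN; rewrite (bigID [in unip F n]) /= big_split /=; congr (_ + _).
  by apply: eq_bigl => h; rewrite inE.
rewrite (reindex_inj (mulgI negI)); apply: eq_bigl => h.
rewrite inE groupMl //; apply: andb_id2l => Hh.
by rewrite mem_negI_unip ?negbK // (subsetP sHG).
Qed.

Lemma card_G_split H : H \subset G F n -> negI \in H ->
  #|H| = (2 * #|H :&: unip F n|)%N.
Proof.
move=> sHG HN; rewrite -!sum1_card !mul2n -addnn.
have := sum_G_split (fun=> 1%N) sHG HN; rewrite big_split; exact.
Qed.

Lemma gQX Q k : (gQ Q ^+ k)%g = gQ (Q *+ k) :> GL.
Proof.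
elim: k => [|k IHk]; last by rewrite expgS IHk gQM mulrS.
by apply: val_inj; rewrite /= -[LHS]/(1%:M) (scalar_mx_block n.+1 n.+1).
Qed.

Lemma unip_exp_p g : g \in unip F n -> (g ^+ p)%g = 1%g.
Proof.
case/imsetP=> Q _ ->; rewrite gQX -(expg0 (gQ 0)) gQX; congr gQ.
by rewrite -scaler_nat pcharf0 // scale0r.
Qed.

Lemma unip_pgroup : p.-group (unip F n).
Proof.
rewrite -pnat_exponent; apply: (@pnat_dvd _ p).
  by apply/exponentP=> g /unip_exp_p.
exact/pnat_id/(pcharf_prime charFp).
Qed.

Lemma sub_unip H : H \subset G F n -> negI \notin H -> H \subset unip F n.
Proof.
move=> sHG; apply: contraR => /subsetPn[h Hh un_h].
have Gh := subsetP sHG h Hh.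
have uNh : (negI * h \in unip F n)%g by rewrite mem_negI_unip.
(* As p is odd, h ^+ p = -I. *)
have : ((negI * h) ^+ p)%g = 1%g by apply: unip_exp_p.
rewrite expgMn; last exact: negI_comm.
have N2 : (negI ^+ 2)%g = 1%g by rewrite expgS expg1 negI2.
rewrite -{1}(odd_double_half p) p_odd expgD -mul2n expgM N2 expg1n mulg1 expg1.
move/(canRL (mulgK _)); rewrite mul1g => ->.
by rewrite groupV groupX.
Qed.

End ElementsOfG.

(** * Multiplicities in the restricted Weil character *)

Section Multiplicities.

Variables (F : finFieldType) (n p : nat).
Variables (charFp : p \in [pchar F]) (p_odd : odd p).
Variables (omega : 'CF(Sp F n)) (omegaW : Weil_character charFp omega).

Local Notation GL := {'GL_(n.+1 + n.+1)[F]}.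
Local Notation negI := (negI F n).
Local Notation dim := (#|F| ^ n.+1)%N.
Implicit Types (g h : GL) (H : {group GL}) (y : 'rV[F]_n.+1).

Let F2 : 2%:R != 0 :> F := pchar_odd_nat2_neq0 charFp p_odd.

(** Reading Q off as the lower left block makes this a function on the whole of GL; it is
    multiplicative on [unip]. *)
Definition quad_char y g : algC :=
  psi charFp (- rowdot (y *m dlsubmx (g : 'M_(n.+1 + n.+1))) y).

Lemma quad_char_gQ y Q : quad_char y (gQ Q) = psi charFp (- rowdot (y *m Q) y).
Proof. by rewrite /quad_char [dlsubmx _]block_mxKdl. Qed.

Lemma quad_charN y g : quad_char (- y) g = quad_char y g.
Proof. by rewrite /quad_char mulNmx rowdotNl rowdotNr opprK. Qed.

Lemma quad_char0 g : quad_char 0 g = 1.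
Proof. by rewrite /quad_char mul0mx rowdot0l oppr0 psi0. Qed.

Lemma quad_charM y :
  {in unip F n &, {morph quad_char y : g h / (g * h)%g >-> g * h}}.
Proof.
move=> _ _ /imsetP[Q _ ->] /imsetP[R _ ->].
by rewrite gQM !quad_char_gQ mulmxDr rowdotDl opprD psiD.
Qed.

Lemma quad_char1 y : quad_char y 1%g = 1.
Proof.
by rewrite -(expg0 (gQ 0)) gQX quad_char_gQ mulmx0 rowdot0l oppr0 psi0.
Qed.

(** The trace formulas on the two cosets of [unip], with [pi] and [W] hidden; on the coset of -I
    only the term y = 0 survives. *)
Lemma Weil_character_on_G : exists mu : GL -> algC,
  [/\ mu 1%g = 1, {in G F n &, {morph mu : g h / (g * h)%g >-> g * h}},
      {in unip F n, forall g, omega g = mu g * \sum_y quad_char y g}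
    & {in unip F n, forall g, omega (negI * g)%g = mu (negI * g)%g}].
Proof.
have [pi [W [Hpi HW ->]]] := omegaW; exists (Weil_eigen pi W).
have trW (b : bool) Q : Q \in sym_mx F n -> cfRepr W (negI ^+ b * gQ Q)%g
   = Weil_eigen pi W (negI ^+ b * gQ Q)%g
     * \sum_y quad_char y (gQ Q) * (b ==> (y == 0))%:R.
  move=> symQ; rewrite cfunE (subsetP (G_sub_Sp F n)) ?mulr1n; last first.
    by rewrite groupM ?groupX ?negI_G // (subsetP (unip_sub_G F n)) ?gQ_unip.
  rewrite (mxtrace_Weil p_odd Hpi HW b symQ).
  by under [in RHS]eq_bigr do rewrite quad_char_gQ.
split.
- exact: (Weil_eigen1 p_odd W Hpi).
- exact: (Weil_eigenM p_odd Hpi HW).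
- move=> _ /imsetP[Q symQ ->]; have := trW false Q symQ.
  by rewrite expg0 mul1g => ->; under eq_bigr do rewrite mulr1.
move=> _ /imsetP[Q symQ ->]; have := trW true Q symQ.
rewrite expg1 => ->; rewrite (bigD1 0) //= big1 => [|y /negbTE->].
  by rewrite eqxx quad_char0 addr0 !mulr1.
by rewrite mulr0.
Qed.

Lemma Weil_character1 : omega 1%g = dim%:R.
Proof. by have [pi [W [_ _ ->]]] := omegaW; rewrite cfRepr1. Qed.

Lemma Weil_character_char : omega \is a character.
Proof. by have [pi [W [_ _ ->]]] := omegaW; apply: cfRepr_char. Qed.

Section LinearTwist.

Variable mu : GL -> algC.
Hypothesis mu1 : mu 1%g = 1.
Hypothesis muM : {in G F n &, {morph mu : g h / (g * h)%g >-> g * h}}.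

Lemma mu_neq0 g : g \in G F n -> mu g != 0.
Proof.
move=> Gg; apply: contra_eq_neq mu1 => mu_g0.
by rewrite -(mulgV g) muM ?groupV // mu_g0 mul0r eq_sym oner_eq0.
Qed.

(** The summand is multiplicative on [K], and since chi has values of modulus 1 it is trivial
    exactly when mu times [quad_char y] agrees with chi on [K]. *)
Lemma sum_quad_lin_char (K : {group GL}) H (chi : 'CF(H)) y :
    K \subset unip F n -> K \subset H -> chi \is a linear_char ->
  \sum_(h in K) mu h * quad_char y h * (chi h)^*
    = [forall h in K, mu h * quad_char y h == chi h]%:R * #|K|%:R.
Proof.
move=> sKU sKH lin_chi; have sKG := subset_trans sKU (unip_sub_G F n).
rewrite (sum_morph (f := fun h => mu h * quad_char y h * (chi h)^*));
  first last.
- by rewrite mu1 quad_char1 lin_char1 // !mul1r conjC1.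
- move=> g h Kg Kh; rewrite muM ?(subsetP sKG) // quad_charM ?(subsetP sKU) //.
  rewrite lin_charM ?(subsetP sKH) // rmorphM /=.
  by rewrite (mulrACA (mu g) (mu h)) (mulrACA (mu g * _)).
congr ((nat_of_bool _)%:R * _); apply: eq_forallb_in => h Kh.
have chi1 : chi h * (chi h)^* = 1.
  by rewrite -normCK normC_lin_char ?expr1n // (subsetP sKH).
have nz_chi : (chi h)^* != 0.
  by apply: contra_eq_neq chi1 => ->; rewrite mulr0 eq_sym oner_eq0.
by rewrite -chi1 (inj_eq (mulIf nz_chi)).
Qed.

End LinearTwist.

Lemma Weil_multfree_negI H :
  H \subset G F n -> multiplicity_free ('Res[H] omega) -> negI \in H.
Proof.
move=> sHG mf; apply: contraT => /(sub_unip charFp p_odd sHG) sHU.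
have [mu [mu1 muM omegaE _]] := Weil_character_on_G.
have [y nz_y] : exists y, y != 0.
  exists (const_mx 1); apply/rV0Pn; exists 0; rewrite mxE; exact: oner_neq0.
have [i Di] : exists i, {in H, 'chi[H]_i =1 fun h => mu h * quad_char y h}.
  apply: morph_irr => [|g h Hg Hh]; first by rewrite mu1 quad_char1 mulr1.
  by rewrite muM ?quad_charM ?(subsetP sHU) ?(subsetP sHG) // mulrACA.
have lin_i : 'chi[H]_i \is a linear_char.
  by apply/char_abelianP/(abelianS sHG)/G_abelian.
have sHS := subset_trans sHG (G_sub_Sp F n).
(* The indices of the lines on which [H] acts by ['chi_i]; their number is the multiplicity, and y
   and - y are two of them. *)
pose A := [set z | [forall h in H, mu h * quad_char z h == 'chi_i h]].
have mult_i : '['Res[H] omega, 'chi_i] = #|A|%:R.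
  rewrite cfdotE; apply: (canLR (mulKf _)); first exact: neq0CG.
  rewrite -[#|A|]sum1_card natr_sum mulr_sumr.
  transitivity (\sum_z \sum_(h in H) mu h * quad_char z h * ('chi_i h)^*).
    rewrite exchange_big; apply: eq_bigr => h Hh.
    by rewrite cfResE // omegaE ?(subsetP sHU) // mulr_sumr mulr_suml.
  rewrite [RHS]big_mkcond; apply: eq_bigr => z _.
  rewrite (sum_quad_lin_char mu1 muM) // inE.
  by case: ifP; rewrite ?mul0r ?mul1r ?mulr1.
have Ay : y \in A by rewrite inE; apply/forall_inP=> h Hh; rewrite Di.
have ANy : - y \in A.
  by rewrite inE; apply/forall_inP=> h Hh; rewrite quad_charN Di.
have ne_y : y != - y.
  by rewrite -subr_eq0 opprK -mulr2n -scaler_nat scaler_eq0 negb_or F2.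
have A2 : (1 < #|A|)%N.
  rewrite (cardsD1 y) Ay (cardsD1 (- y)) 2!inE ANy eq_sym ne_y //.
have : '['Res[H] omega, 'chi_i] = 1.
  by apply: mf; rewrite irr_consttE mult_i pnatr_eq0 -lt0n ltnW.
by rewrite mult_i => /eqP; rewrite pnatr_eq1 => /eqP DA; rewrite DA in A2.
Qed.

Lemma Weil_multfree_order H :
  H \subset G F n -> multiplicity_free ('Res[H] omega) -> (2 * dim <= #|H|)%N.
Proof.
move=> sHG mf; have HN := Weil_multfree_negI sHG mf.
have sHS := subset_trans sHG (G_sub_Sp F n).
have := multiplicity_free_abelian_degree (abelianS sHG (G_abelian F n)) mf.
rewrite cfResE ?group1 // Weil_character1 ler_nat.
rewrite (card_G_split charFp) // leq_pmul2l //.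
have p_pr := pcharf_prime charFp.
have p_gt2 : (2 < p)%N.
  by case: (p) p_pr p_odd => [|[|[|]]].
have [a ->] : exists a, #|H :&: unip F n| = (p ^ a)%N.
  have /p_natP[a Da] : p.-group (H :&: unip F n)%g.
    exact: pgroupS (subsetIr _ _) (unip_pgroup n charFp).
  by exists a.
have [b ->] : exists b, dim = (p ^ b)%N.
  have := card_pprimeChar charFp; set k := logn _ _ => DF.
  by exists (k * n.+1)%N; rewrite expnM -DF.
rewrite leq_exp2l ?(ltnW p_gt2) //.
(* If a < b, then p^(a+1) <= p^b <= 2 p^a, against p > 2. *)
move=> le_b; rewrite leqNgt; apply/negP => lt_ab.
have := leq_trans (leq_pexp2l (prime_gt0 p_pr) lt_ab) le_b.
by rewrite expnS leq_pmul2r ?expn_gt0 ?prime_gt0 // leqNgt p_gt2.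
Qed.

Lemma Weil_multfree_separated H :
    H \subset G F n -> negI \in H ->
    (forall y z, {in H :&: unip F n, quad_char y =1 quad_char z} ->
       y = z \/ y = - z) ->
  multiplicity_free ('Res[H] omega).
Proof.
move=> sHG HN sep i; rewrite irr_consttE.
have [mu [mu1 muM omegaE omegaNE]] := Weil_character_on_G.
have lin_i : 'chi[H]_i \is a linear_char.
  by apply/char_abelianP/(abelianS sHG)/G_abelian.
have sHS := subset_trans sHG (G_sub_Sp F n).
pose K := (H :&: unip F n)%G.
have [sKH sKU] : K \subset H /\ K \subset unip F n.
  by rewrite subsetIl subsetIr.
have sKG := subset_trans sKH sHG.
pose A := [set z | [forall h in K, mu h * quad_char z h == 'chi_i h]].
(* The sum over [H] is split into [K] and its coset by -I. The coset only sees the line of 0, with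
   the constant factor [c]; the factor 2 below is the index of [K] in [H]. *)
pose c := mu negI * ('chi_i negI)^*.
have mult_i : 2%:R * '['Res[H] omega, 'chi_i] = #|A|%:R + c * (0 \in A)%:R.
  apply: (mulfI (neq0CG K)).
  rewrite mulrA -natrM mulnC -(card_G_split charFp p_odd sHG HN) cfdotE.
  rewrite mulVKf ?neq0CG // (sum_G_split charFp p_odd) // big_split mulrDr /=.
  congr (_ + _).
    rewrite -[#|A|]sum1_card natr_sum mulr_sumr.
    transitivity (\sum_z \sum_(h in K) mu h * quad_char z h * ('chi_i h)^*).
      rewrite exchange_big; apply: eq_bigr => h Kh.
      rewrite cfResE ?(subsetP sKH) // omegaE ?(subsetP sKU) //.
      by rewrite mulr_sumr mulr_suml.
    rewrite [RHS]big_mkcond; apply: eq_bigr => z _.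
    rewrite (sum_quad_lin_char mu1 muM) // inE.
    by case: ifP; rewrite ?mul0r ?mul1r ?mulr1.
  rewrite inE mulrCA [_ * _%:R]mulrC -(sum_quad_lin_char mu1 muM) // mulr_sumr.
  apply: eq_bigr => h Kh; have Hh := subsetP sKH h Kh.
  rewrite cfResE ?groupM // omegaNE ?(subsetP sKU) //.
  rewrite muM ?negI_G ?(subsetP sKG) // quad_char0 mulr1.
  by rewrite lin_charM // rmorphM mulrACA.
have norm_c : `|c| = 1.
  rewrite normrM norm_conjC normC_lin_char // mulr1; apply/eqP.
  rewrite -(@pexpr_eq1 _ _ 2) // -normrX expr2 -muM ?negI_G // negI2 mu1.
  by rewrite normr1.
(* By separation, [A] is empty, or equals {0} and both terms are 1, or lies in a pair {z, - z} and
   omits 0. *)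
have A_le2 : (#|A| + (0%R \in A) <= 2)%N.
  have A_pm y z : y \in A -> z \in A -> y = z \/ y = - z.
    rewrite !inE => /forall_inP Ay /forall_inP Az; apply: sep => h Kh.
    apply: (mulfI (mu_neq0 mu1 muM (subsetP sKG h Kh))).
    by rewrite (eqP (Ay h Kh)) (eqP (Az h Kh)).
  have [A0 | _] := boolP (0 \in A).
    have sA0 : A \subset [set 0].
      apply/subsetP=> y Ay; rewrite inE.
      by have [->|->] := A_pm y 0 Ay A0; rewrite ?oppr0.
    by rewrite addn1 ltnS (leq_trans (subset_leq_card sA0)) ?cards1.
  have [-> | [z Az]] := set_0Vmem A; first by rewrite cards0.
  rewrite addn0 (leq_trans (subset_leq_card (_ : A \subset [set z; - z]))) //.
    apply/subsetP=> y Ay; rewrite !inE.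
    by have [->|->] := A_pm y z Ay Az; rewrite eqxx ?orbT.
  by rewrite cards2; case: (_ != _).
have /natrP[m Dm] : '['Res[H] omega, 'chi_i] \is a Num.nat.
  by rewrite Cnat_cfdot_char ?irr_char // cfRes_char ?Weil_character_char.
rewrite Dm in mult_i *; rewrite pnatr_eq0 -lt0n => m_gt0.
suffices m_le1 : (m <= 1)%N by apply/eqP; rewrite pnatr_eq1 eqn_leq m_le1.
rewrite -(leq_pmul2l (ltn0Sn 1)) (leq_trans _ A_le2) // -(ler_nat algC).
rewrite natrM -[leLHS]ger0_norm ?mulr_ge0 ?ler0n // mult_i natrD.
by rewrite (le_trans (ler_normD _ _)) // normrM norm_c mul1r !normr_nat.
Qed.

End Multiplicities.

(** * The trace forms Q_alpha *)

Section TraceForms.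

Variables (F : finFieldType) (L : fieldExtType F) (n : nat).
Variable zeta : n.+1.-tuple L.
Implicit Types (a b : L) (y : 'rV[F]_n.+1).

Local Notation tr a := (fieldTrace (a : finvect_type L)).

Definition coord_sum y : L := \sum_i y 0 i *: tnth zeta i.

Lemma trace_mx_sym a : trace_mx zeta a \in sym_mx F n.
Proof. by rewrite inE; apply/eqP/matrixP=> i j; rewrite !mxE mulrAC. Qed.

Lemma trace_mxD a b : trace_mx zeta (a + b) = trace_mx zeta a + trace_mx zeta b.
Proof.
apply/matrixP=> i j; rewrite !mxE !mulrDl.
exact: (@fieldTraceD F (finvect_type L)).
Qed.

Lemma trace_mx0 : trace_mx zeta 0 = 0.
Proof. by apply: (addrI (trace_mx zeta 0)); rewrite -trace_mxD !addr0. Qed.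

(** Expand one factor of Y^2, then the other, in the zeta_i and use linearity of the trace. *)
Lemma trace_form a y :
  rowdot (y *m trace_mx zeta a) y = tr (a * coord_sum y ^+ 2).
Proof.
have trZ c x : tr (c *: x) = c * tr x := @fieldTraceZ F (finvect_type L) c x.
have tr_sum (f : 'I_n.+1 -> L) : tr (\sum_i f i) = \sum_i tr (f i).
  exact: (@fieldTrace_sum F (finvect_type L)).
rewrite /rowdot mxE expr2 mulrA {2}/coord_sum mulr_sumr tr_sum.
apply: eq_bigr => j _; rewrite -scalerAr trZ mulrC [y^T _ _]mxE mxE.
congr (_ * _); rewrite /coord_sum mulr_sumr mulr_suml tr_sum.
by apply: eq_bigr => i _; rewrite mxE -scalerAr -scalerAl trZ.
Qed.

Hypothesis zeta_basis : basis_of {:L} zeta.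

Lemma coord_sum_inj : injective coord_sum.
Proof.
move=> y z eq_yz; have /freeP zeta_free := basis_free zeta_basis.
apply/rowP=> i; apply/eqP; rewrite -subr_eq0; apply/eqP.
apply: (zeta_free (fun i => y 0 i - z 0 i)).
under eq_bigr do rewrite scalerBl -!tnth_nth.
by rewrite sumrB -[LHS]/(coord_sum y - coord_sum z) eq_yz subrr.
Qed.

Lemma coord_sumN y : coord_sum (- y) = - coord_sum y.
Proof.
by rewrite /coord_sum -sumrN; apply: eq_bigr => i _; rewrite mxE scaleNr.
Qed.

(** If Y^2 - Z^2 were nonzero, tr(a (Y^2 - Z^2)) would take every value in F as a varies, including
    one where psi is not 1. So Y^2 = Z^2, and Y = Z or Y = - Z in the field [L]. *)
Lemma trace_form_separates (p : nat) (charFp : p \in [pchar F]) y z :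
    odd p ->
    (forall a, quad_char charFp y (gQ (trace_mx zeta a))
             = quad_char charFp z (gQ (trace_mx zeta a))) ->
  y = z \/ y = - z.
Proof.
move=> p_odd eq_yz.
suffices /eqP : coord_sum y ^+ 2 = coord_sum z ^+ 2.
  rewrite eqf_sqr => /orP[] /eqP; first by left; apply: coord_sum_inj.
  by rewrite -coord_sumN; right; apply: coord_sum_inj.
apply/eqP; rewrite -subr_eq0; apply: contraT => nz_d.
have [c /eqP[]] := psi_nontrivial charFp p_odd.
have [a <-] : exists a, tr (a * (coord_sum y ^+ 2 - coord_sum z ^+ 2)) = c.
  exact: (@fieldTrace_nondeg F (finvect_type L)).
have := eq_yz a; rewrite !quad_char_gQ !trace_form !psiN // => /invr_inj eq_psi.
set d := tr (a * _); have nz_psi := psi_neq0 charFp p_odd.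
rewrite -(mulfK (nz_psi (tr (a * coord_sum z ^+ 2))) (psi _ _)) /d mulrBr.
rewrite -psiD // -(@fieldTraceD F (finvect_type L)) subrK eq_psi divff //.
Qed.

Definition trace_unip : {set {'GL_(n.+1 + n.+1)[F]}} :=
  [set gQ (trace_mx zeta a) | a : finvect_type L].

Lemma trace_unip_group_set : group_set trace_unip.
Proof.
apply/group_setP; split=> [|_ _ /imsetP[a _ ->] /imsetP[b _ ->]].
  apply/imsetP; exists 0 => //.
  by rewrite trace_mx0 -(expg0 (gQ 0)) gQX.
by apply/imsetP; exists (a + b); rewrite // gQM -trace_mxD.
Qed.
Canonical trace_unip_group := Group trace_unip_group_set.

Lemma trace_unip_sub : trace_unip \subset unip F n.
Proof. by apply/subsetP=> _ /imsetP[a _ ->]; apply/gQ_unip/trace_mx_sym. Qed.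

Lemma card_trace_unip : (#|trace_unip| <= #|F| ^ \dim {:L})%N.
Proof.
rewrite (leq_trans (leq_imset_card _ _)) //.
rewrite -(@card_vspace F (finvect_type L) _ fullv).
by apply/subset_leq_card/subsetP=> a _; apply: memvf.
Qed.

End TraceForms.

Theorem mainTheorem2 (F : finFieldType) (p n : nat)
    (charFp : p \in [pchar F]) (p_odd : odd p)
    (omega : 'CF(Sp F n)) (omegaW : Weil_character charFp omega) :
  (forall H : {group {'GL_(n.+1 + n.+1)[F]}},
     H \subset G F n -> multiplicity_free ('Res[H] omega) ->
     (2 * #|F| ^ n.+1 <= #|H|)%N)
  /\
  (forall (L : fieldExtType F) (zeta : n.+1.-tuple L),
     \dim {:L} = n.+1 -> basis_of {:L} zeta ->
     exists H : {group {'GL_(n.+1 + n.+1)[F]}},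
       [/\ (<[negI F n]> \x
              [set gQ (trace_mx zeta alpha) | alpha : finvect_type L])%g = H,
           H \subset G F n,
           #|H| = (2 * #|F| ^ n.+1)%N
         & multiplicity_free ('Res[H] omega)]).
Proof.
split=> [H | L zeta dimL zeta_basis].
  exact: (Weil_multfree_order p_odd omegaW).
have F2 := pchar_odd_nat2_neq0 charFp p_odd.
have [_ _ cNU TI] := dprodP (G_dprod n F2).
set K := trace_unip_group zeta; have sKU := trace_unip_sub zeta.
pose H := (<[negI F n]> <*> K)%G.
have DH : (<[negI F n]> \x K = H)%g.
  apply: dprodEY; first exact: subset_trans sKU cNU.
  by apply/trivgP; rewrite -TI setIS.
have sHG : H \subset G F n by rewrite genS // setUS.
have HN : negI F n \in H by rewrite mem_gen // inE cycle_id.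
have mfH : multiplicity_free ('Res[H] omega).
  apply: (Weil_multfree_separated p_odd omegaW sHG HN) => y z eq_yz.
  apply: (trace_form_separates zeta_basis p_odd) => a; apply: eq_yz.
  have Ka : gQ (trace_mx zeta a) \in K by apply/imsetP; exists a.
  by rewrite inE (subsetP sKU) // mem_gen // inE Ka orbT.
(* The lower bound on the order is part (1) applied to [H] itself; the upper bound counts the
   parameters alpha and the powers of -I. *)
exists H; split=> //; apply/eqP; rewrite eqn_leq andbC.
rewrite (Weil_multfree_order p_odd omegaW sHG mfH) /=.
rewrite -(dprod_card DH) leq_mul //; last first.
  by rewrite (leq_trans (card_trace_unip zeta)) ?dimL.
rewrite -[leqLHS]/(#[negI F n])%g dvdn_leq // order_dvdn expgS expg1.
by apply/eqP; apply: negI2.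
Qed.
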